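(* Let $t$ be the unique real root of the equation $t\,(2\log t+1/2)=2\log 2-1/2$ (numerically $t=1.1463411865\ldots$), and let $c=1+1/t=1.8723406362\ldots$. Then there is a function $\varepsilon:\mathbb{N}\to\mathbb{R}$ with $\varepsilon(n)=o(n)$ as $n\to\infty$ such that the following holds. For every $n$, every polynomial $f$ of degree $n$ which can be written as $f=gh$ with $g,h$ nonconstant integer-valued polynomials satisfies $P(f)\le cn+\varepsilon(n)$.
   Context: A polynomial $f\in\mathbb{Q}[x]$ is integer-valued if $f(m)\in\mathbb{Z}$ for every $m\in\mathbb{Z}$. $P(f)=\#\{m\in\mathbb{Z}: |f(m)|\text{ is a prime number}\}$. *)

(* Defs.v *)
From HB Require Import structures.
From mathcomp Require Import all_boot all_order all_algebra.
From mathcomp Require Import all_classical all_reals all_analysis.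
Set Implicit Arguments. Unset Strict Implicit. Unset Printing Implicit Defensive.
Import Order.TTheory GRing.Theory Num.Theory.
Local Open Scope ring_scope.

Definition int_valued (f : {poly rat}) : Prop :=
  forall m : int, exists z : int, f.[m%:~R] = z%:~R.

Definition abs_prime_at (f : {poly rat}) (m : int) : bool :=
  [exists p : 'I_(`|numq f.[m%:~R]|%N).+1, prime p && (`|f.[m%:~R]| == (p : nat)%:R)].

Definition little_o_n (R : realType) (eps : nat -> R) : Prop :=
  forall e : R, 0 < e -> exists N : nat, forall n : nat, (N <= n)%N ->
    `|eps n| <= e * n%:R.

(* Main.v *)
Require Import Defs.
From HB Require Import structures.
From mathcomp Require Import all_boot all_order all_algebra all_field.
From mathcomp Require Import all_classical all_reals all_analysis.
From mathcomp Require Import zify ring lra.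
Set Implicit Arguments. Unset Strict Implicit. Unset Printing Implicit Defensive.
Import Order.TTheory GRing.Theory Num.Theory.
Local Open Scope ring_scope.

(** If [|g m * h m|] is prime then [|g m| = 1] or [|h m| = 1], so it suffices to
    show that an integer-valued [g] of degree [a] has [|g| = 1] at [N] integers
    with only [N <= 5a/3 + O(1)]; the constant [1 + 1/t] exceeds [5/3].

    Let [x_0 < ... < x_(N-1)] be these integers.  As [a! * lead_coef g] is a
    nonzero integer, [|g / lead_coef g| <= a!] at every [x_i].  The map
    [x_i |-> i] does not increase distances, hence (McShane) neither does its
    extension [z |-> min_i (i + |x_i - z|)] to the complex plane, measured from
    the [x_i].  Moving the roots of [g] along it gives a monic [q] of degree [a]
    with [|q| <= a!] on [{0, ..., N-1}].

    Pairing [q] with the discrete Chebyshev (Gram) polynomial of degree [a] on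
    [{0, ..., N-1}], given by its Rodrigues formula, and using Cauchy-Schwarz
    yields [C(N+a, 2a+1) <= N * C(2a, a)].  With [2a+1 ~ 3j] and
    [N = a+1+j ~ 5a/3] the left side is at least
    [C(4j, j) >= (256/27)^j / (4j+1)], whereas the right side is [O(j * 8^j)],
    a contradiction for large [j]. *)

(** * Forward differences of polynomials and summation by parts *)

Section ForwardDifference.
Variable R : comNzRingType.
Implicit Types (p q : {poly R}) (x : R).

Definition fdiff p : {poly R} := p \Po ('X + 1) - p.

Lemma horner_fdiff p x : (fdiff p).[x] = p.[x + 1] - p.[x].
Proof. by rewrite /fdiff hornerD hornerN horner_comp !hornerE. Qed.

Lemma fdiff_MXaddC p c : fdiff (p * 'X + c%:P) = fdiff p * 'X + fdiff p + p.
Proof. by rewrite /fdiff comp_polyD comp_polyM comp_polyX comp_polyC; ring. Qed.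

(** Stated with a size bound and the coefficient at [n], not [lead_coef], so that it iterates
    without tracking exact degrees. For [n = 0] both coefficients vanish. *)
Lemma fdiff_lead p n : (size p <= n.+1)%N ->
  (size (fdiff p) <= n)%N /\ (fdiff p)`_n.-1 = n%:R * p`_n.
Proof.
elim: n p => [|n IHn] p.
  move=> /size1_polyC ->.
  by rewrite /fdiff comp_polyC subrr size_poly0 coef0 mul0r.
elim/poly_ind: p => [|p c _] sz_p.
  by rewrite /fdiff comp_poly0 subrr size_poly0 !coef0 mulr0.
have {}sz_p : (size p <= n.+1)%N.
  have := sz_p; rewrite size_MXaddC; case: ifP => // /andP[/eqP-> _].
  by rewrite size_poly0.
have [sz_dp lead_dp] := IHn p sz_p.
rewrite fdiff_MXaddC; split.
  rewrite (leq_trans (size_polyD _ _)) // geq_max sz_p andbT.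
  rewrite (leq_trans (size_polyD _ _)) // geq_max (leqW sz_dp) andbT.
  have [->|nz] := eqVneq (fdiff p) 0; first by rewrite mul0r size_poly0.
  by rewrite size_mulX.
move: (fdiff p) sz_dp lead_dp => dp sz_dp lead_dp.
rewrite !coefD !coefMX coefC /= addr0 [dp`_n]nth_default // addr0.
case: n lead_dp {IHn sz_p sz_dp} => [_|n /= ->] /=; first by ring.
by rewrite -[n.+2%:R]natr1; ring.
Qed.

Lemma iter_fdiff_lead p k n : (size p <= (n + k).+1)%N ->
  (size (iter k fdiff p) <= n.+1)%N /\
  (iter k fdiff p)`_n = ((n + k) ^_ k)%:R * p`_(n + k).
Proof.
elim: k p => [|k IHk] p; first by rewrite addn0 ffactn0 mul1r.
rewrite addnS => sz_p; have [sz_dp lead_dp] := fdiff_lead sz_p.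
rewrite iterSr; have [? ->] := IHk _ sz_dp; split=> //.
by rewrite lead_dp ffactSS natrM; ring.
Qed.

Lemma iter_fdiff_const p k x : (size p <= k.+1)%N ->
  (iter k fdiff p).[x] = (k`!)%:R * p`_k.
Proof.
move=> sz_p; have [] := @iter_fdiff_lead p k 0%N sz_p.
by rewrite !add0n ffactnn => /size1_polyC -> /=; rewrite hornerC coefC eqxx.
Qed.

Lemma horner_iter_fdiff_eq0 p k x :
  (forall i, (i <= k)%N -> p.[x + i%:R] = 0) -> (iter k fdiff p).[x] = 0.
Proof.
elim: k x => [|k IHk] x p0 /=; first by have := p0 0%N; rewrite addr0 => ->.
rewrite horner_fdiff (IHk x) ?(IHk (x + 1)) ?subrr// => i le_ik.
  by rewrite -addrA nat1r p0.
by rewrite p0 // leqW.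
Qed.

(** Abel summation: the two sides differ by the telescoping sum of the differences of [p(m+i) q(i)],
    whose end terms vanish by hypothesis. *)
Lemma sum_by_parts p q (n m : nat) :
  p.[m%:R] = 0 -> p.[(m + n)%:R] = 0 ->
  \sum_(i < n) (fdiff p).[(m + i)%:R] * q.[i%:R] =
  - \sum_(i < n) p.[(m.+1 + i)%:R] * (fdiff q).[i%:R].
Proof.
move=> pm pmn; apply/eqP; rewrite -addr_eq0 -big_split /=; apply/eqP.
rewrite -(big_mkord xpredT (fun i => (fdiff p).[(m + i)%:R] * q.[i%:R] +
  p.[(m.+1 + i)%:R] * (fdiff q).[i%:R])) /=.
rewrite (eq_bigr (fun i => p.[(m + i.+1)%:R] * q.[i.+1%:R]
                         - p.[(m + i)%:R] * q.[i%:R])); last first.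
  by move=> i _; rewrite !horner_fdiff !natr1 addSn addnS; ring.
by rewrite telescope_sumr // addn0 pm pmn !mul0r subrr.
Qed.

End ForwardDifference.

(** * Binomial and falling factorial identities, and Cauchy-Schwarz *)

(** Combinatorially, the (a+b+1)-subsets of an (n+a)-set are sorted by the position a+i of their
    element of rank a+1. *)
Lemma sum_bin_convolution (n a b : nat) :
  (\sum_(i < n) 'C(a + i, a) * 'C(n.-1 - i, b) = 'C(n + a, (a + b).+1))%N.
Proof.
elim: b n => [|b IHb] n.
  elim: n => [|n IHn]; first by rewrite big_ord0 addn0 bin_small.
  rewrite big_ord_recr /= bin0 muln1 addSn binS [in 'C(a + n, a)]addnC addn0.
  move: IHn; rewrite addn0 => <-; congr (_ + _)%N.
  by apply: eq_bigr => i _; rewrite !bin0.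
elim: n => [|n IHn]; first by rewrite big_ord0 bin_small //; lia.
rewrite big_ord_recr /= subnn bin0n muln0 addn0 addSn binS -{1}IHn addnS -IHb.
rewrite -big_split; apply: eq_bigr => i _ /=.
have lt_in := ltn_ord i.
have -> : (n - i = (n.-1 - i).+1)%N by lia.
by rewrite binS mulnDr.
Qed.

Lemma natr_ffact (R : pzRingType) (n m : nat) :
  (n ^_ m)%:R = \prod_(u < m) (n%:R - u%:R) :> R.
Proof.
elim: m => [|m IHm]; first by rewrite big_ord0.
rewrite big_ord_recr /= -IHm ffactnSr natrM.
have [le_mn|lt_nm] := leqP m n; first by rewrite natrB.
by rewrite ffact_small // !mul0r.
Qed.

(** Cauchy-Schwarz against the all-ones vector, from expanding the nonnegative sum of the squares of
    n|u_i| - T. *)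
Lemma sqr_sum_norm_le (F : numDomainType) (n : nat) (u : 'I_n -> F) :
  (\sum_i `|u i|) ^+ 2 <= n%:R * \sum_i `|u i| ^+ 2.
Proof.
case: n u => [|n] u; first by rewrite !big_ord0 expr0n mulr0.
set T := \sum_i `|u i|; set E := \sum_i _.
have T_real : T \is Num.real by apply: rpred_sum => i _; apply: normr_real.
have : 0 <= \sum_i (n.+1%:R * `|u i| - T) ^+ 2.
  apply: sumr_ge0 => i _; rewrite real_exprn_even_ge0 //.
  by rewrite rpredB // rpredM ?realn ?normr_real.
have -> : \sum_i (n.+1%:R * `|u i| - T) ^+ 2 =
    n.+1%:R * (n.+1%:R * E - T ^+ 2).
  transitivity (\sum_(i < n.+1) (n.+1%:R ^+ 2 * `|u i| ^+ 2
     - n.+1%:R * T *+ 2 * `|u i| + T ^+ 2)); first by apply: eq_bigr => i _; ring.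
  rewrite big_split sumrB -!mulr_sumr /= sumr_const card_ord -/T -/E.
  by ring.
by rewrite pmulr_rge0 ?ltr0Sn // subr_ge0.
Qed.

(** * Discrete Chebyshev polynomials and monic polynomials bounded on an interval of integers *)

Section DiscreteChebyshev.
Variables (F : numFieldType) (n a : nat).
Implicit Type q : {poly F}.

(** The roots are 0, ..., a-1 and n, ..., n+a-1. The second block is listed downwards so that at a+i
    its factors match those of the falling factorial of n-1-i up to sign. *)
Definition rodrigues_poly : {poly F} :=
  \prod_(u < a) ('X - (u%:R)%:P) * \prod_(u < a) ('X - ((n + a - u.+1)%:R)%:P).

Definition chebyshev_poly : {poly F} := iter a (@fdiff F) rodrigues_poly.

Lemma horner_rodrigues (m : nat) : rodrigues_poly.[m%:R] =
  (\prod_(u < a) (m%:R - u%:R)) * \prod_(u < a) (m%:R - (n + a - u.+1)%:R).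
Proof.
by rewrite /rodrigues_poly hornerM !horner_prod; congr (_ * _);
  apply: eq_bigr => u _; rewrite hornerXsubC.
Qed.

Lemma horner_rodrigues_eq0 (m : nat) :
  (m < a)%N || (n <= m < n + a)%N -> rodrigues_poly.[m%:R] = 0.
Proof.
rewrite horner_rodrigues => /orP[lt_ma|/andP[le_nm lt_mna]].
  by rewrite (bigD1 (Ordinal lt_ma)) //= subrr !mul0r.
have lt_u : (n + a - m.+1 < a)%N by lia.
rewrite mulrC (bigD1 (Ordinal lt_u)) //=.
by have -> : (n + a - (n + a - m.+1).+1 = m)%N; [lia | rewrite subrr !mul0r].
Qed.

Lemma horner_rodrigues_shift (i : nat) : (i < n)%N ->
  rodrigues_poly.[(a + i)%:R] =
  (-1) ^+ a * (((a + i) ^_ a) * ((n.-1 - i) ^_ a))%:R.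
Proof.
move=> lt_in; rewrite horner_rodrigues natrM -natr_ffact mulrCA; congr (_ * _).
rewrite natr_ffact -[a in (-1) ^+ a]card_ord -prodr_const -big_split /=.
apply: eq_bigr => u _; rewrite mulN1r opprB.
have lt_ua := ltn_ord u.
rewrite !natrB; [|lia|lia].
rewrite -[in n.-1%:R]subn1 natrB; last by lia.
by rewrite !natrD -natr1; ring.
Qed.

Lemma rodrigues_lead : (size rodrigues_poly <= (a + a).+1)%N /\
  rodrigues_poly`_(a + a) = 1.
Proof.
have sz_u (f : 'I_a -> F) : size (\prod_(u < a) ('X - (f u)%:P)) = a.+1.
  by rewrite size_prod_XsubC /index_enum -enumT size_enum_ord.
have mon_u (f : 'I_a -> F) : \prod_(u < a) ('X - (f u)%:P) \is monic.
  by apply: monic_prod_XsubC.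
have mon : rodrigues_poly \is monic by rewrite monicMr.
have sz : size rodrigues_poly = (a + a).+1.
  by rewrite /rodrigues_poly size_monicM ?monic_neq0 ?mon_u // !sz_u /= addnS.
by split; [rewrite sz | move/monicP: mon; rewrite lead_coefE sz].
Qed.

(** The boundary terms at k and n+k involve the (a-k-1)-th difference, hence only values at k, ...,
    a-1 and n+k, ..., n+a-1, all roots of [rodrigues_poly]. *)
Lemma chebyshev_by_parts q (k : nat) : (k <= a)%N ->
  \sum_(i < n) chebyshev_poly.[i%:R] * q.[i%:R] =
  (-1) ^+ k * \sum_(i < n) (iter (a - k) (@fdiff F) rodrigues_poly).[(k + i)%:R]
                * (iter k (@fdiff F) q).[i%:R].
Proof.
elim: k => [|k IHk] lt_ka; first by rewrite mul1r subn0.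
rewrite (IHk (ltnW lt_ka)).
have -> : (a - k = (a - k.+1).+1)%N by lia.
rewrite iterS (@sum_by_parts F _ (iter k (@fdiff F) q)).
- by rewrite [(-1) ^+ k.+1]exprSr -[RHS]mulrA mulN1r.
- apply: horner_iter_fdiff_eq0 => i le_i.
  by rewrite -natrD horner_rodrigues_eq0 //; lia.
apply: horner_iter_fdiff_eq0 => i le_i.
by rewrite -natrD horner_rodrigues_eq0 //; lia.
Qed.

(** After [a] summations by parts [q] has become the constant a! q_a; the binomial convolution
    evaluates the remaining sum, and the two signs (-1)^a cancel. *)
Lemma chebyshev_sum q : (size q <= a.+1)%N ->
  \sum_(i < n) chebyshev_poly.[i%:R] * q.[i%:R] =
  (a`! ^ 3 * 'C(n + a, a.*2.+1))%:R * q`_a.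
Proof.
move=> sz_q; rewrite (chebyshev_by_parts q (leqnn a)) subnn /=.
under eq_bigr => i _ do
  rewrite horner_rodrigues_shift // iter_fdiff_const // -mulrA.
rewrite -mulr_sumr mulrA -exprD -signr_odd oddD addbb expr0 mul1r.
rewrite -mulr_suml -natr_sum mulrA -natrM; congr (_%:R * _).
rewrite -addnn -sum_bin_convolution big_distrr big_distrl /=.
by apply: eq_bigr => i _; rewrite -!bin_ffact; ring.
Qed.

Lemma chebyshev_lead : (size chebyshev_poly <= a.+1)%N /\
  chebyshev_poly`_a = (a.*2 ^_ a)%:R.
Proof.
have [sz lead] := rodrigues_lead; have [? ->] := iter_fdiff_lead sz.
by split; rewrite // lead mulr1 addnn.
Qed.

Lemma chebyshev_real (m : nat) : chebyshev_poly.[m%:R] \is Num.real.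
Proof.
rewrite /chebyshev_poly; elim: {1}a m => [|k IHk] m.
  by rewrite horner_rodrigues rpredM // rpred_prod // => u _;
    rewrite rpredB ?realn.
by rewrite iterS horner_fdiff natr1 rpredB.
Qed.

(** Pairing P with [q] bounds the sum of |P| from below by a!^2 S; pairing P with itself gives the
    sum of |P|^2 exactly. Cauchy-Schwarz compares the two, and a!^4 S cancels. *)
Lemma bin_le_of_bounded_monic q : (size q <= a.+1)%N -> q`_a = 1 ->
  (forall i, (i < n)%N -> `|q.[i%:R]| <= a`!%:R) ->
  ('C(n + a, a.*2.+1) <= n * 'C(a.*2, a))%N.
Proof.
move=> sz_q lead_q q_le; set S := 'C(_, _).
have [-> // | S_gt0] := posnP S.
set P := chebyshev_poly; have [sz_P lead_P] := chebyshev_lead.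
have a_gt0 : (0 : F) < a`!%:R by rewrite ltr0n fact_gt0.
have sumPq : (a`! ^ 2 * S)%:R <= \sum_(i < n) `|P.[i%:R]|.
  have sumE : \sum_(i < n) P.[i%:R] * q.[i%:R] = (a`! ^ 3 * S)%:R.
    by rewrite chebyshev_sum // lead_q mulr1.
  rewrite -(ler_pM2l a_gt0) -natrM mulnA -expnS -sumE.
  have /ger0_norm <- : 0 <= \sum_(i < n) P.[i%:R] * q.[i%:R].
    by rewrite sumE ler0n.
  rewrite (le_trans (ler_norm_sum _ _ _)) // mulr_sumr; apply: ler_sum => i _.
  by rewrite normrM mulrC ler_wpM2r // q_le.
have sumPP : \sum_(i < n) `|P.[i%:R]| ^+ 2 =
    (a`! ^ 3 * S * a.*2 ^_ a)%:R.
  rewrite natrM -lead_P -chebyshev_sum //; apply: eq_bigr => i _.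
  by rewrite real_normK ?chebyshev_real.
have := sqr_sum_norm_le (fun i : 'I_n => P.[i%:R]).
rewrite sumPP -natrM => /(le_trans _)-/(_ ((a`! ^ 2 * S)%:R ^+ 2)).
rewrite lerXn2r ?nnegrE ?ler0n ?sumr_ge0 // => /(_ isT).
rewrite -natrX ler_nat -bin_ffact.
have -> : ((a`! ^ 2 * S) ^ 2 = (a`! ^ 4 * S) * S)%N by ring.
have -> : (n * (a`! ^ 3 * S * ('C(a.*2, a) * a`!)) =
  (a`! ^ 4 * S) * (n * 'C(a.*2, a)))%N by ring.
by rewrite leq_pmul2l // muln_gt0 expn_gt0 fact_gt0.
Qed.

End DiscreteChebyshev.

(** * Moving the points to consecutive integers *)

(** With [y] the minimum, attained at [k], minimality gives y - i <= |x_i - z|. Conversely i - k <=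
    |x_i - x_k|, and the triangle inequality through [z] bounds i - y. *)
Lemma exists_contraction (F : numFieldType) (n : nat) (x : 'I_n -> F) (z : F) :
  (forall i j : 'I_n, `|(i : nat)%:R - (j : nat)%:R| <= `|x i - x j|) ->
  exists y : F, forall i : 'I_n, `|(i : nat)%:R - y| <= `|x i - z|.
Proof.
case: n x => [|n] x x_exp; first by exists 0 => -[].
pose d (i : 'I_n.+1) : F := (i : nat)%:R + `|x i - z|.
have d_real i : d i \is Num.real by rewrite rpredD ?realn ?normr_real.
have [k _ d_min] := real_arg_minP (i0 := ord0) (P := xpredT) (F := d) isT
  (fun i _ => d_real i).
exists (d k) => i; rewrite real_ler_norml ?rpredB ?realn //.
apply/andP; split; first by rewrite lerBrDl -lerBrDr opprK d_min.
rewrite /d opprD addrA lerBlDr (le_trans (real_ler_norm _)) ?rpredB ?realn //.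
by rewrite (le_trans (x_exp i k)) // [`|x k - z|]distrC ler_distD.
Qed.

Lemma sorted_int_spread (s : seq int) (i j : nat) : sorted <%O s ->
  (i <= j < size s)%N -> (j - i)%:Z <= s`_j - s`_i.
Proof.
move=> s_sorted; elim: j => [|j IHj] /andP[le_ij lt_js].
  by move: le_ij; rewrite leqn0 => /eqP ->; rewrite subrr.
have [->|ne_ij] := eqVneq i j.+1; first by rewrite subnn subrr.
have := IHj ltac:(lia).
have : s`_j < s`_j.+1 by rewrite lt_sorted_ltn_nth ?inE // ltnW.
lia.
Qed.

(** The nonzero number a! [lead_coef g] is the a-th difference of [g] at 0, hence an integer. *)
Lemma fact_lead_ge1 (g : {poly rat}) (a : nat) : int_valued g ->
  size g = a.+1 -> 1 <= `|a`!%:R * lead_coef g|.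
Proof.
move=> g_int sz_g.
have int_k k (m : nat) : (iter k (@fdiff rat) g).[m%:R] \is a Num.int.
  elim: k m => [|k IHk] m /=.
    by have [z gz] := g_int m%:Z; apply/intrP; exists z.
  by rewrite horner_fdiff natr1 rpredB.
have := int_k a 0%N; rewrite iter_fdiff_const ?sz_g // lead_coefE sz_g /=.
move=> /norm_intr_ge1; apply.
have : lead_coef g != 0 by rewrite lead_coef_eq0 -size_poly_eq0 sz_g.
rewrite lead_coefE sz_g /= => nz.
by rewrite mulf_neq0 // pnatr_eq0 -lt0n fact_gt0.
Qed.

Lemma unit_values_bin_le (g : {poly rat}) (a : nat) (s : seq int) :
  int_valued g -> size g = a.+1 -> uniq s ->
  all (fun m : int => `|g.[m%:~R]| == 1) s ->
  ('C(size s + a, a.*2.+1) <= size s * 'C(a.*2, a))%N.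
Proof.
move=> g_int sz_g s_uniq /allP g_unit.
pose s' := sort <=%O s; pose x (i : 'I_(size s)) : algC := (s'`_i)%:~R.
have sz_s' : size s' = size s by rewrite size_sort.
have s'_sorted : sorted <%O s' by rewrite sort_lt_sorted.
have x_exp (i j : 'I_(size s)) :
    `|(i : nat)%:R - (j : nat)%:R| <= `|x i - x j|.
  have spread : (`|(i : nat)%:Z - (j : nat)%:Z| <= `|s'`_i - s'`_j|)%R.
    have [le_ij|/ltnW le_ji] := leqP i j.
      have := @sorted_int_spread s' i j s'_sorted.
      by rewrite sz_s' le_ij ltn_ord => /(_ isT); lia.
    have := @sorted_int_spread s' j i s'_sorted.
    by rewrite sz_s' le_ji ltn_ord => /(_ isT); lia.
  rewrite -[(i : nat)%:R]/((i : nat)%:Z%:~R) -[(j : nat)%:R]/((j : nat)%:Z%:~R).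
  by rewrite /x -!intrB -!intr_norm ler_int.
pose G : {poly algC} := map_poly ratr g.
have [r def_G] := closed_field_poly_normal G.
have lead_G : lead_coef G = ratr (lead_coef g) by rewrite lead_coef_map.
have nz_lead : lead_coef G != 0.
  by rewrite lead_coef_eq0 map_poly_eq0 -size_poly_eq0 sz_g.
have sz_r : size r = a.
  have : size G = a.+1 by rewrite size_map_poly.
  by rewrite def_G size_scale // size_prod_XsubC => -[].
have [y y_le] : exists y : algC -> algC, forall z (i : 'I_(size s)),
    `|(i : nat)%:R - y z| <= `|x i - z|.
  have /boolp.choice[y y_le] := fun z => exists_contraction z x_exp.
  by exists y.
pose q := \prod_(z <- r) ('X - (y z)%:P).
have sz_q : size q = a.+1 by rewrite size_prod_XsubC sz_r.
apply: (@bin_le_of_bounded_monic _ _ _ q); rewrite ?sz_q //.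
  have /monicP : q \is monic by apply: monic_prod_XsubC.
  by rewrite lead_coefE sz_q.
move=> i lt_i; pose k := Ordinal lt_i.
have Gx : `|G.[x k]| = 1.
  rewrite /G /x -[(_ %:~R)](ratr_int algC) horner_map -ratr_norm.
  have /g_unit/eqP -> : s'`_i \in s.
    by rewrite -(mem_sort <=%O) mem_nth // sz_s'.
  by rewrite rmorph1.
have le1 : 1 <= a`!%:R * `|lead_coef G|.
  have := fact_lead_ge1 g_int sz_g.
  rewrite lead_G normrM normr_nat -ratr_norm -(ler_rat algC).
  by rewrite rmorphM /= ratr_nat rmorph1.
(* Root by root, |i - y(z)| <= |x_i - z|, so the product is at most |G(x_i)| = 1. *)
have q_le : `|q.[i%:R]| * `|lead_coef G| <= 1.
  rewrite -[leRHS]Gx [in leRHS]def_G hornerZ normrM mulrC ler_wpM2l //.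
  rewrite !horner_prod !normr_prod; apply: ler_prod => z _.
  by rewrite normr_ge0 /= !hornerXsubC; apply: (y_le z k).
rewrite -(@ler_pM2r _ `|lead_coef G|) ?normr_gt0 //.
exact: le_trans q_le le1.
Qed.

(** * Growth of binomial coefficients *)

(** These are the terms of (1+3)^(4j). The ratio of term i+1 to term i, 3(4j-i)/(i+1), is at least 1
    for i < 3j and at most 1 from i = 3j on. *)
Lemma bin4_mode (j k : nat) : (k <= 4 * j)%N ->
  ('C(4 * j, k) * 3 ^ k <= 'C(4 * j, 3 * j) * 3 ^ (3 * j))%N.
Proof.
have step i : ('C(4 * j, i.+1) * i.+1 = (4 * j - i) * 'C(4 * j, i))%N.
  by rewrite mulnC mul_bin_left.
move=> le_k; have [le_k3|lt_3k] := leqP k (3 * j).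
  rewrite -[X in (_ <= 'C(_, X) * 3 ^ X)%N](subnKC le_k3).
  have : (k + (3 * j - k) <= 3 * j)%N by lia.
  elim: (_ - _)%N => [|d IHd] le_d; first by rewrite addn0.
  rewrite (leq_trans (IHd _)) //; first by lia.
  rewrite addnS expnS; have := step (k + d)%N.
  move: ('C(_, _)) ('C(_, _)) (3 ^ _)%N => v u w uv.
  suff : (v <= u * 3)%N by nia.
  nia.
have -> : k = (3 * j + (k - 3 * j))%N by lia.
elim: (_ - _)%N => [|d IHd]; first by rewrite addn0.
rewrite (leq_trans _ IHd) // addnS expnS; have := step (3 * j + d)%N.
move: ('C(_, _)) ('C(_, _)) (3 ^ _)%N => v u w uv.
suff : (u * 3 <= v)%N by nia.
rewrite -(leq_pmul2r (ltn0Sn (3 * j + d))) mulnAC uv.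
have : ((4 * j - (3 * j + d)) * 3 <= (3 * j + d).+1)%N by lia.
by move: (_ - _)%N => c le_c; nia.
Qed.

(** The largest of the 4j+1 terms of (1+3)^(4j) is at least their average. *)
Lemma bin4_ge (j : nat) :
  (4 ^ (4 * j) <= (4 * j).+1 * ('C(4 * j, j) * 3 ^ (3 * j)))%N.
Proof.
have -> : ('C(4 * j, j) = 'C(4 * j, 3 * j))%N.
  by rewrite -bin_sub; [congr 'C(_, _); lia | lia].
rewrite -[X in (X ^ _)%N]/(1 + 3)%N expnDn.
have -> u : ((4 * j).+1 * u = \sum_(i < (4 * j).+1) u)%N.
  by rewrite sum_nat_const card_ord.
by apply: leq_sum => i _; rewrite exp1n mul1n bin4_mode // -ltnS.
Qed.

(** Here 32/27 is the quotient of the competing growth rates 256/27 and 8; the quadratic collects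
    the polynomial losses. *)
Lemma expn_ratio_gt (R : realFieldType) (j : nat) : (90 <= j)%N ->
  27 ^+ j * ((4 * j%:R + 1) * (5 * j%:R + 3)) < 32 ^+ j :> R.
Proof.
move=> /subnKC <-; elim: (_ - _)%N => [|i IHi].
  rewrite addn0 -[90%N]/(5 * 18)%N !exprM.
  (* Hence (32/27)^90 >= 2^18 = 262144, which exceeds 361 * 453 = 163533. *)
  have base : (27 ^+ 5 * 2 <= 32 ^+ 5 :> R) by lra.
  have : (27 ^+ 5 * 2) ^+ 18 <= (32 ^+ 5) ^+ 18 :> R.
    by rewrite lerXn2r ?nnegrE //; lra.
  rewrite exprMn; apply: lt_le_trans.
  rewrite ltr_pM2l ?exprn_gt0 //; last by lra.
rewrite addnS; move: (90 + i)%N (leq_addr i 90) IHi => k le_k IHk.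
rewrite !exprS; have k_ge : (90 : R) <= k%:R by rewrite (ler_nat R 90 k).
have p_gt0 : (0 : R) < 27 ^+ k by rewrite exprn_gt0 // ltr0n.
rewrite -[k.+1%:R]natr1; set x : R := k%:R in IHk k_ge *.
apply: le_lt_trans (_ : 32 * (27 ^+ k * ((4 * x + 1) * (5 * x + 3))) < _).
  rewrite [leLHS](_ : _ = 27 ^+ k *
    (27 * ((4 * (x + 1) + 1) * (5 * (x + 1) + 3)))); last by ring.
  rewrite [leRHS](_ : _ = 27 ^+ k * (32 * ((4 * x + 1) * (5 * x + 3))));
    last by ring.
  rewrite ler_pM2l //; nra.
by rewrite ltr_pM2l // ltr0n.
Qed.

(** * Counting the points where an integer-valued polynomial is 1 or -1 *)

(** The points are roots of g^2 - 1. This crude bound handles small degrees. *)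
Lemma unit_values_le_double (g : {poly rat}) (s : seq int) :
  (1 < size g)%N -> uniq s -> all (fun m : int => `|g.[m%:~R]| == 1) s ->
  (size s <= (size g).-1.*2)%N.
Proof.
move=> sz_g s_uniq /allP g_unit.
have nz_g : g != 0 by rewrite -size_poly_gt0 ltnW.
have sz_g2 : size (g ^+ 2 - 1) = (size g).-1.*2.+1.
  have sz_sq : size (g ^+ 2) = (size g).-1.*2.+1.
    by rewrite expr2 size_mul //; case: (size g) sz_g => // n _ /=; lia.
  rewrite size_polyDl ?sz_sq // size_polyN size_poly1.
  by case: (size g) sz_g => // -[].
rewrite -ltnS -sz_g2 -(size_map (intr : int -> rat)).
apply: max_poly_roots; first by rewrite -size_poly_gt0 sz_g2.
  apply/allP => _ /mapP[m m_s ->]; have /eqP gm := g_unit m m_s.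
  by rewrite rootE !hornerE -real_normK ?num_real // gm expr1n subrr.
by rewrite map_inj_uniq //; apply: intr_inj.
Qed.

Lemma bin_le_expn2 (n k : nat) : ('C(n, k) <= 2 ^ n)%N.
Proof.
have [le_kn|lt_nk] := leqP k n; last by rewrite bin_small.
rewrite -[2%N]/(1 + 1)%N expnDn (bigD1 (Ordinal (le_kn : (k < n.+1)%N))) //=.
by rewrite !exp1n !muln1 leq_addr.
Qed.

Lemma unit_values_le (g : {poly rat}) (s : seq int) :
  int_valued g -> (1 < size g)%N -> uniq s ->
  all (fun m : int => `|g.[m%:~R]| == 1) s ->
  (3 * size s <= 5 * (size g).-1 + 810)%N.
Proof.
move=> g_int sz_g s_uniq g_unit; set a := (size g).-1.
have sz_a : size g = a.+1 by rewrite prednK // ltnW.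
have le_2a := unit_values_le_double sz_g s_uniq g_unit.
(* If j < 90 then a <= 134, and 2a points fit the bound. Otherwise a + j points suffice, as 3j <=
   2a+1. *)
pose j := (a.*2.+1 %/ 3)%N; have [lt_j|le_j] := ltnP j 90; first by lia.
suff : (size s <= a + j)%N by lia.
rewrite leqNgt; apply/negP => lt_s.
(* Keeping exactly a+j+1 points turns the binomial into C(2a+1+j, j), which is at least C(4j, j). *)
have := @unit_values_bin_le g a (take (a + j).+1 s) g_int sz_a
  (take_uniq _ s_uniq).
rewrite size_takel // => /(_ _); set B := 'C(_, _) => B_le.
have {}B_le : (B <= (a + j).+1 * 2 ^ a.*2)%N.
  apply: leq_trans (B_le _) _; first by apply/allP => m /mem_take /(allP g_unit).
  by rewrite leq_mul2l bin_le_expn2 orbT.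
have B_ge : ('C(4 * j, j) <= B)%N.
  have -> : B = 'C(a.*2.+1 + j, j).
    by rewrite /B -[in RHS]bin_sub ?leq_addl // addnK; congr 'C(_, _); lia.
  by apply: leq_bin2l; lia.
(* Rounding in [j] costs at most 2: 2a <= 3j+1. *)
have pow_le : (2 ^ a.*2 <= 2 * 2 ^ (3 * j))%N.
  by rewrite -expnS leq_exp2l //; lia.
have {}B_le : (B <= (5 * j + 3) * 2 ^ (3 * j))%N.
  have : (2 * (a + j).+1 <= 5 * j + 3)%N by lia.
  move: pow_le B_le; move: (2 ^ _)%N (2 ^ _)%N => u v; nia.
(* This is 32^j <= 27^j (4j+1)(5j+3), the negation of [expn_ratio_gt]; multiplying by 2^(3j) makes
   the left side 4^(4j). *)
have key : (2 ^ (5 * j) <= 3 ^ (3 * j) * ((4 * j + 1) * (5 * j + 3)))%N.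
  rewrite -(leq_pmul2r (_ : 0 < 2 ^ (3 * j))%N) ?expn_gt0 // -expnD.
  have -> : (5 * j + 3 * j = 2 * (4 * j))%N by lia.
  rewrite expnM (leq_trans (bin4_ge j)) // -addn1.
  rewrite [leqRHS](_ : _ = (4 * j + 1) * ((5 * j + 3) * 2 ^ (3 * j) *
    3 ^ (3 * j)))%N; last by ring.
  by rewrite leq_mul2l leq_mul2r (leq_trans B_ge B_le) !orbT.
have := @expn_ratio_gt rat _ le_j; rewrite real_ltNge ?num_real //.
move/negP; apply; move: key; rewrite -(ler_nat rat) natrM !natrX !exprM.
rewrite (natrM _ (4 * j + 1)%N) (natrD _ _ 1%N) (natrD _ _ 3%N) !(natrM _ _ j).
suff [-> ->] : (27 = 3 ^+ 3 :> rat) * (32 = 2 ^+ 5 :> rat) by [].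
by split; lra.
Qed.

(** * Prime values of a product and the constant 1 + 1/t *)

Lemma abs_prime_factor (g h : {poly rat}) (m : int) :
  int_valued g -> int_valued h -> abs_prime_at (g * h) m ->
  (`|g.[m%:~R]| == 1) || (`|h.[m%:~R]| == 1).
Proof.
move=> /(_ m)[u gm] /(_ m)[v hm] /existsP[p' /andP[]].
move: (nat_of_ord p') => p p_prime {p'}.
have normE (w : int) : `|w%:~R : rat| = `|w|%N%:R.
  by rewrite -intr_norm -abszE -pmulrn.
rewrite hornerM gm hm -intrM !normE eqr_nat !pnatr_eq1 abszM => /eqP def_p.
have /primeP[_ /(_ `|u|%N)] := p_prime; rewrite -def_p dvdn_mulr // => /(_ isT).
case/orP=> [-> //|/eqP u_uv]; apply/orP; right.
have : (0 < `|u| * `|v|)%N by rewrite def_p prime_gt0.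
by rewrite muln_gt0 => /andP[u_gt0 _]; rewrite -(eqn_pmul2l u_gt0) muln1 -u_uv.
Qed.

(** If t > 3/2 then ln t >= 1 - 1/t >= 1/3, so the left side exceeds 7/4, while the right side is at
    most 3/2 because ln 2 <= 1. *)
Lemma root_le_three_halves (R : realType) (t : R) :
  t * (2 * ln t + 2^-1) = 2 * ln 2 - 2^-1 -> t <= 3 / 2.
Proof.
move=> t_root; rewrite leNgt; apply/negP => lt_t.
have ln2_le : ln (2 : R) <= 1.
  by have := @le_ln1Dx R 1; rewrite -natr1; apply; lra.
have lnt_ge : 3^-1 <= ln t.
  have : ln (t^-1) <= t^-1 - 1.
    have := @le_ln1Dx R (t^-1 - 1); rewrite [1 + _]addrC subrK; apply.
    by rewrite ltrBrDr addNr invr_gt0; lra.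
  have : t^-1 <= 2 / 3 by rewrite -[2 / 3]invf_div lef_pV2 ?posrE; lra.
  by rewrite lnV ?posrE; lra.
nra.
Qed.

Lemma little_o_cst (R : realType) (C : R) : little_o_n (fun=> C).
Proof.
move=> e e_gt0; exists (Num.bound (`|C| / e)) => n le_n.
rewrite mulrC -ler_pdivrMr // ltW // (lt_le_trans (archi_boundP _)) ?ler_nat //.
by rewrite divr_ge0 // ltW.
Qed.

Theorem theorem2 (R : realType) (t : R) :
  0 < t ->
  t * (2 * ln t + 2^-1) = 2 * ln 2 - 2^-1 ->
  exists eps : nat -> R, little_o_n eps /\
    forall (n : nat) (f g h : {poly rat}),
      size f = n.+1 ->
      f = g * h -> (1 < size g)%N -> (1 < size h)%N ->
      int_valued g -> int_valued h ->
      forall s : seq int, uniq s -> all (abs_prime_at f) s ->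
        (size s)%:R <= (1 + t^-1) * n%:R + eps n.
Proof.
(* Each factor contributes an error of 810/3, so 540 in total. *)
move=> t_gt0 t_root; exists (fun=> 540); split; first exact: little_o_cst.
move=> n f g h sz_f def_f sz_g sz_h g_int h_int s s_uniq /allP f_prime.
have tV_ge : 2 / 3 <= t^-1.
  have t_le := root_le_three_halves t_root.
  by rewrite -[2 / 3]invf_div lef_pV2 ?posrE //; lra.
pose unit_at (p : {poly rat}) (m : int) := `|p.[m%:~R]| == 1.
have size_le : (size s <= size [seq m <- s | unit_at g m] +
    size [seq m <- s | unit_at h m])%N.
  rewrite !size_filter -count_predUI -[size s](count_predT s).
  rewrite (leq_trans _ (leq_addr _ _)) // -!size_filter.
  rewrite (@eq_in_filter _ predT (predU (unit_at g) (unit_at h))) // => m m_s.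
  by rewrite /= abs_prime_factor // -def_f f_prime.
have le_g := unit_values_le g_int sz_g (filter_uniq (unit_at g) s_uniq)
  (filter_all _ _).
have le_h := unit_values_le h_int sz_h (filter_uniq (unit_at h) s_uniq)
  (filter_all _ _).
have def_n : ((size g).-1 + (size h).-1 = n)%N.
  have nz_g : g != 0 by rewrite -size_poly_gt0 ltnW.
  have nz_h : h != 0 by rewrite -size_poly_gt0 ltnW.
  move: sz_f; rewrite def_f (size_mul nz_g nz_h).
  by case: (size g) sz_g => // u _; case: (size h) sz_h => // v _ /=; lia.
have : (3 * size s <= 5 * n + 1620)%N.
  rewrite -def_n (leq_trans (leq_mul (leqnn 3) size_le)) // !mulnDr.
  by rewrite (leq_trans (leq_add le_g le_h)) // addnACA.
rewrite -(ler_nat R) natrM (natrD _ _ 1620) natrM => le_s.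
have : 2 / 3 * n%:R <= t^-1 * n%:R by rewrite ler_wpM2r // ler0n.
by lra.
Qed.
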